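(* Let $L,S\ge1$ be integers, let $\beta$ be the positive solution of $L\beta+S\beta^2=1$, and let $f_{L,S}:[0,1)\to[0,1)$ be the interval exchange transformation of $L+S$ intervals $I_1,\ldots,I_{L+S}$ defined in the context. Let $r\in\mathbb{Z}$ be arbitrary, choose $q_0\in\mathbb{Z}$ such that $\{-r\beta-q_0\beta^2\}\in I_1$ but $\{-r\beta-(q_0+1)\beta^2\}\notin I_1$, and set $x_0=\{-r\beta-q_0\beta^2\}$. If $L\ge S$, then there exists an ordering of the orbit points $f_{L,S}^i(x_0)$, $i\in\mathbb{Z}$, such that the corresponding sequence is a low-discrepancy sequence in $[0,1)$.
   Context: For a real number $z$, $\{z\}=z-\lfloor z\rfloor$ denotes its fractional part. The map $f_{L,S}$: partition $[0,1)$ from left to right into consecutive half-open intervals $I_1,\ldots,I_{L+S}$ (left endpoints included), where $I_i$ has length $\beta$ for $1\le i\le L$ and length $\beta^2$ for $L+1\le i\le L+S$. In particular $I_1=[0,\beta)$. The bijective map $f_{L,S}:[0,1)\to[0,1)$ rearranges these intervals by translations so that their left-to-right order after applying $f_{L,S}$ is $I_2,\ldots,I_L,\ I_{L+S},\ I_1,\ I_{L+1},\ldots,I_{L+S-1}$. Explicitly, $f_{L,S}(x)=x+w_i$ for $x\in I_i$, where $$w_1=(L-1)\beta+\beta^2,\qquad w_i=-\beta\ \ (2\le i\le L),\qquad w_i=\beta^2\ \ (L+1\le i\le L+S-1),\qquad w_{L+S}=-(S-1)\beta^2-\beta.$$ For $n<0$, $f_{L,S}^n$ denotes the corresponding power of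 the inverse map. Low discrepancy: for a sequence $X=(x_n)_{n\ge0}$ in $[0,1)$, the star-discrepancy of its first $N$ points is $D_N^*(X)=\sup_{0<t<1}\left|\frac{\#\{n:0\le n<N,\ x_n\in[0,t)\}}{N}-t\right|$. The sequence $X$ is a low-discrepancy sequence if $D_N^*(X)=O(N^{-1}\log N)$ as $N\to\infty$. An ordering of a countably infinite set is an enumeration of its elements as a sequence indexed by $n\ge0$. *)

(* Defs.v *)
From mathcomp Require Export all_boot all_order all_algebra.
From mathcomp Require Export all_classical all_reals all_analysis.
Export Order.TTheory GRing.Theory Num.Theory.
Export numFieldNormedType.Exports.

Set Implicit Arguments.
Unset Strict Implicit.
Unset Printing Implicit Defensive.

Local Open Scope classical_set_scope.
Local Open Scope ring_scope.

Definition fract (R : realType) (z : R) : R := z - (Num.floor z)%:~R.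

(* The intervals are indexed by i = 1, ..., L + S. *)

Definition ls_length (R : realType) (L : nat) (beta : R) (i : nat) : R :=
  if (i <= L)%N then beta else beta ^+ 2.

Definition ls_left (R : realType) (L : nat) (beta : R) (i : nat) : R :=
  \sum_(1 <= j < i) ls_length L beta j.

Definition ls_interval (R : realType) (L : nat) (beta : R) (i : nat) : set R :=
  [set` `[ls_left L beta i, ls_left L beta i + ls_length L beta i[%R].

Definition ls_shift (R : realType) (L S : nat) (beta : R) (i : nat) : R :=
  if i == 1%N then (L%:R - 1) * beta + beta ^+ 2
  else if (i <= L)%N then - beta
  else if (i < L + S)%N then beta ^+ 2
  else - (S%:R - 1) * beta ^+ 2 - beta.

(* The intervals are disjoint, so at most one term of the sum is nonzero: the
   map is x + ls_shift i on the i-th interval, and the identity off [0, 1). *)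
Definition ls_map (R : realType) (L S : nat) (beta : R) (x : R) : R :=
  x + \sum_(1 <= i < (L + S).+1)
        ls_shift L S beta i * \1_(ls_interval L beta i) x.

(* Negz n is the integer - n.+1; pinv is the inverse of the restriction of
   ls_map to [0, 1), a bijection of [0, 1) when L * beta + S * beta ^ 2 = 1. *)
Definition ls_iter (R : realType) (L S : nat) (beta : R) (i : int) (x : R) : R :=
  match i with
  | Posz n => iter n (ls_map L S beta) x
  | Negz n =>
      iter n.+1 (pinv (`[0, 1[ : set R) (ls_map L S beta)) x
  end.

Definition ls_orbit (R : realType) (L S : nat) (beta : R) (x : R) : set R :=
  range (fun i : int => ls_iter L S beta i x).

Definition star_discrepancy (R : realType) (x : nat -> R) (N : nat) : R :=
  sup [set `| #|[pred n : 'I_N | 0 <= x n < t]|%:R / N%:R - t |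
      | t in `]0, 1[ ].

Definition low_discrepancy (R : realType) (x : nat -> R) : Prop :=
  (forall n, x n \in `[0, 1[) /\
  (star_discrepancy x : nat -> R^o)
    =O_\oo (fun N : nat => N%:R^-1 * ln N%:R : R^o).

Definition ordering (R : realType) (A : set R) (x : nat -> R) : Prop :=
  set_bij [set: nat] A x.

(* Main.v *)
Require Import Defs.
From mathcomp Require Import lra zify ring.

(** The map f acts on [0, 1) with a dense orbit, and density alone suffices:
    every countable dense subset of [0, 1) can be enumerated with low
    discrepancy.

    Density of the orbit.  The first return of f to I_1 = [0, beta) is the
    rotation u |-> u + beta ^ 2 modulo beta ([first_return]): from I_1 a point
    either lands in I_L, or lands in I_{L+1}, climbs through all the short
    intervals and drops into I_L; from I_L it descends through the long
    intervals back to I_1.  On its way the orbit visits the translate of the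
    return point in every long interval and, when the return point is below
    beta ^ 2, in every short one.  So it is enough that a rotation by beta
    modulo 1 has dense forward orbits, that is, that q * beta - p takes
    arbitrarily small positive values ([rotation_dense]).  Here S <= L enters:
    mu = S * beta is then smaller than 1, it satisfies mu ^ 2 = S - L * mu, and
    the odd powers of mu are small positive numbers of the form q * mu - p with
    q and p natural ([beta_small_multiples]).

    From density to low discrepancy.  The binary van der Corput sequence has
    counting error at most k + 1 on its first N <= 2 ^ k points, because the
    even-indexed and the odd-indexed points are copies of the same sequence
    shrunk into the two halves of [0, 1) ([vdc_discrepancy]).  A dense set A
    contains, for every n, unused points within 2 ^ - n of the n-th van der
    Corput point; choosing such a point at every n that is not a power of two,
    and spending the powers of two on the leftover elements of A, enumerates A
    exactly once ([sparse_bijection]).  Among the first N points only O(log N)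
    are leftovers or have n < k, and all the others are within 2 ^ - k <= 1 / N
    to the right of their models, so the counting error stays O(log N)
    ([perturbed_vdc_discrepancy]). *)

Set Implicit Arguments.
Unset Strict Implicit.

Local Open Scope classical_set_scope.
Local Open Scope ring_scope.

(** * Enumerations with prescribed behaviour off a sparse set of times *)

(** The enumeration is built greedily: at a time in [A] the least unused value
    is taken, which makes it surjective because [A] is unbounded; at the other
    times an unused value with property [P] is taken. *)
Lemma sparse_bijection (A : pred nat) (P : nat -> nat -> Prop) :
    (forall i, exists2 n, (i <= n)%N & A n) ->
    (forall n (s : seq nat), exists2 m, m \notin s & P n m) ->
  exists sigma : nat -> nat,
    [/\ injective sigma, forall j, exists n, sigma n = j
      & forall n, ~~ A n -> P n (sigma n)].
Proof.
move=> Aoo Poo.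
have step (ns : nat * seq nat) : exists m, m \notin ns.2 /\
    (if A ns.1 then forall j, (j < m)%N -> j \in ns.2 else P ns.1 m).
  case: ns => n s /=; case: (A n); last by have [m] := Poo n s; exists m.
  have ex_m : exists m, [pred m | m \notin s] m.
    by have [m ms _] := Poo 0%N s; exists m.
  case: (ex_minnP ex_m) => m ms m_min; exists m; split=> // j.
  by rewrite ltnNge; apply: contraR; exact: m_min.
have [g gP] := choice step.
(* pre n lists the values chosen before time n *)
pose pre := fix pre (n : nat) : seq nat :=
  if n is n'.+1 then rcons (pre n') (g (n', pre n')) else [::].
pose sigma n := g (n, pre n).
have mem_pre k n : (n < k)%N -> sigma n \in pre k.
  elim: k => // k IH; rewrite ltnS leq_eqVlt /= mem_rcons inE.
  by case/predU1P => [->|/IH ->]; rewrite ?eqxx ?orbT.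
have pre_mem k m : m \in pre k -> exists n, sigma n = m.
  elim: k => // k IH /=; rewrite mem_rcons inE => /predU1P[->|/IH//].
  by exists k.
have pre_mono k l m : (k <= l)%N -> m \in pre k -> m \in pre l.
  move=> /subnK <-; elim: (l - k)%N => // d IH mk.
  by rewrite addSn /= mem_rcons inE IH ?orbT.
have fresh k n : (n < k)%N -> sigma n <> sigma k.
  move=> nk eq_nk; have [/negP[]] := gP (k, pre k).
  by rewrite -/(sigma k) -eq_nk mem_pre.
exists sigma; split.
- by move=> n k eq_nk; case: (ltngtP n k) => // /fresh; rewrite eq_nk.
- have all_used j : exists k, forall i, (i < j)%N -> i \in pre k.
    elim: j => [|j [k kP]]; first by exists 0%N.
    have [n kn An] := Aoo k; exists n.+1 => i; rewrite ltnS leq_eqVlt.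
    case/predU1P=> [->|/kP ik]; last exact: (pre_mono k _ _ (leqW kn)).
    have [_ least] := gP (n, pre n); rewrite /= An -/(sigma n) in least.
    case: (ltngtP j (sigma n)) => [jn|nj|->]; last exact: mem_pre.
    + by apply: (pre_mono n) => //; exact: least.
    + by have [/negP[]] := gP (n, pre n); exact: (pre_mono k) (kP _ nj).
  by move=> j; have [k kP] := all_used j.+1; exact: pre_mem (kP j (ltnSn j)).
- by move=> n /negPf nA; have [_ /=] := gP (n, pre n); rewrite nA.
Qed.

(** * The van der Corput sequence *)

(** The digit reversal of [n] truncated to its [k] lowest binary digits. *)
Fixpoint vdc_upto (R : realType) (k n : nat) : R :=
  if k is k'.+1 then ((odd n)%:R + vdc_upto R k' n./2) / 2 else 0.

(** Since n < 2 ^ n, all the binary digits of [n] are among the lowest [n]. *)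
Definition vdc (R : realType) (n : nat) : R := vdc_upto R n n.

Lemma vdc_upto_stable (R : realType) (k l n : nat) :
  (n <= k)%N -> (n <= l)%N -> vdc_upto R k n = vdc_upto R l n.
Proof.
have vdc0 m : vdc_upto R m 0 = 0.
  by elim: m => //= m ->; rewrite add0r mul0r.
elim: k l n => [|k IH] l n; first by rewrite leqn0 => /eqP->; rewrite !vdc0.
case: l => [|l]; first by rewrite leqn0 => _ /eqP->; rewrite !vdc0.
by move=> nk nl /=; rewrite (IH l) //; lia.
Qed.

Lemma vdcE (R : realType) (n : nat) :
  vdc R n = ((odd n)%:R + vdc R n./2) / 2.
Proof.
rewrite /vdc (@vdc_upto_stable _ n n.+1) //=.
by rewrite (@vdc_upto_stable _ n n./2) //; lia.
Qed.

Lemma vdc_itv (R : realType) (n : nat) : 0 <= vdc R n < 1.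
Proof.
rewrite /vdc; suff upto_itv k m : 0 <= vdc_upto R k m < 1 by [].
elim: k m => [|k IH] m /=; first by rewrite lexx ltr01.
by have := IH m./2; case: (odd m) => /=; lra.
Qed.

Definition nb_below (R : realType) (x : nat -> R) (t : R) (N : nat) : nat :=
  count (fun n => x n < t) (iota 0 N).

Lemma nb_belowS (R : realType) (x : nat -> R) (t : R) (N : nat) :
  nb_below x t N.+1 = (nb_below x t N + (x N < t)%R)%N.
Proof. by rewrite /nb_below -addn1 iotaD count_cat /= add0n addn0. Qed.

(** Even indices give the points y / 2 and odd indices the points (1 + y) / 2,
    with y running over the initial terms of the same sequence. *)
Lemma nb_below_vdcE (R : realType) (t : R) (N : nat) :
  nb_below (vdc R) t N =
  (nb_below (vdc R) (2 * t) (uphalf N) + nb_below (vdc R) (2 * t - 1) N./2)%N.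
Proof.
elim: N => // N IH; rewrite nb_belowS IH /=.
rewrite {1}uphalf_half vdcE; case: (boolP (odd N)) => oN /=.
  rewrite uphalf_half oN add1n !nb_belowS -!addnA; do 3![congr addn].
  congr nat_of_bool.
  by rewrite ltr_pdivrMr //; apply/idP/idP; lra.
rewrite uphalf_half (negPf oN) !add0n nb_belowS.
rewrite addnAC; do 2![congr addn]; congr nat_of_bool.
by rewrite ltr_pdivrMr //; apply/idP/idP; lra.
Qed.

Lemma nb_below_le0 (R : realType) (x : nat -> R) (t : R) (N : nat) :
  (forall n, 0 <= x n) -> t <= 0 -> nb_below x t N = 0%N.
Proof.
move=> x0 t0; rewrite /nb_below (@eq_count _ _ pred0) ?count_pred0 // => n /=.
by apply/negbTE; rewrite -leNgt (le_trans t0).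
Qed.

Lemma nb_below_ge1 (R : realType) (x : nat -> R) (t : R) (N : nat) :
  (forall n, x n < 1) -> 1 <= t -> nb_below x t N = N.
Proof.
move=> x1 t1; rewrite /nb_below (@eq_count _ _ predT) => [|n /=].
  by rewrite count_predT size_iota.
by rewrite (lt_le_trans (x1 n)).
Qed.

(** By [nb_below_vdcE] one of the two halves of the sequence lies entirely on
    one side of t, and the other one reduces the problem to about N / 2 points;
    the parity of N costs an error of at most one per halving. *)
Lemma vdc_discrepancy (R : realType) (k N : nat) (t : R) :
  (N <= 2 ^ k)%N -> 0 <= t <= 1 ->
  `|(nb_below (vdc R) t N)%:R - N%:R * t| <= k.+1%:R.
Proof.
have vdc0 n : 0 <= vdc R n by have /andP[] := vdc_itv R n.
have vdc1 n : vdc R n < 1 by have /andP[] := vdc_itv R n.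
elim: k N t => [|k IH] N t.
  rewrite expn0; case: N => [|[|//]] _ t01.
    by rewrite /nb_below ler_norml /=; lra.
  by rewrite nb_belowS /nb_below ler_norml /=; case: (_ < t); rewrite /=; lra.
rewrite expnS => N2k t01; rewrite nb_below_vdcE.
have NE : N%:R = (uphalf N)%:R + (N./2)%:R :> R.
  by rewrite -natrD; congr _%:R; lia.
have half_le : (N./2)%:R <= (uphalf N)%:R :> R by rewrite ler_nat; lia.
have half_ge : (uphalf N)%:R <= (N./2)%:R + 1 :> R.
  by rewrite natr1 ler_nat; lia.
rewrite -(natr1 k.+1); have [t_le|t_gt] := leP t (1/2).
  rewrite [X in (_ + X)%N]nb_below_le0 ?addn0 //; last by lra.
  have : `|(nb_below (vdc R) (2 * t) (uphalf N))%:R - (uphalf N)%:R * (2 * t)|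
      <= k.+1%:R by apply: IH; [lia | lra].
  by rewrite !ler_norml NE; nra.
rewrite [X in (X + _)%N]nb_below_ge1 //; last by lra.
have : `|(nb_below (vdc R) (2 * t - 1) N./2)%:R - (N./2)%:R * (2 * t - 1)|
    <= k.+1%:R by apply: IH; [lia | lra].
by rewrite !ler_norml NE natrD; nra.
Qed.

(** * Counting error of a perturbed sequence *)

Lemma count_mem_le (T : eqType) (s r : seq T) :
  uniq r -> (count [in s] r <= size s)%N.
Proof.
move=> r_uniq; rewrite -size_filter uniq_leq_size ?filter_uniq // => x.
by rewrite mem_filter => /andP[].
Qed.

Definition is_pow2 (n : nat) : bool := (n == 2 ^ trunc_log 2 n)%N.

(** Off the exceptional indices [s], [x n < t] forces [y n < t], and
    [y n < t - d] forces [x n < t]. *)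
Lemma nb_below_perturb (R : realType) (x y : nat -> R) (d t : R)
    (s : seq nat) (N : nat) :
    (forall n, (n < N)%N -> n \notin s -> y n <= x n < y n + d) ->
  (nb_below x t N <= nb_below y t N + size s)%N /\
  (nb_below y (t - d) N <= nb_below x t N + size s)%N.
Proof.
move=> xy.
have key (u v : nat -> R) (a b : R) :
    (forall n, (n < N)%N -> n \notin s -> u n < a -> v n < b) ->
  (nb_below u a N <= nb_below v b N + size s)%N.
  move=> uv.
  rewrite (leq_trans _ (leq_add (leqnn _) (count_mem_le s (iota_uniq 0 N)))) //.
  rewrite /nb_below -count_predUI (leq_trans _ (leq_addr _ _)) //.
  rewrite -!size_filter uniq_leq_size ?filter_uniq ?iota_uniq // => n.
  rewrite !mem_filter mem_iota /= add0n => /andP[ua nN].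
  rewrite nN /= andbT; case: (boolP (n \in s)) => ns; first by rewrite orbT.
  by rewrite (uv n nN ns ua).
by split; apply: key => n nN ns; have := xy n nN ns; lra.
Qed.

(** The exceptional indices are the powers of two and the n < k; elsewhere the
    perturbation is at most 2 ^ - k, and moving t by that much changes N * t by
    at most one. *)
Lemma perturbed_vdc_discrepancy (R : realType) (x : nat -> R) (k N : nat)
    (t : R) :
    (forall n, 0 <= x n) ->
    (forall n, ~~ is_pow2 n -> vdc R n <= x n < vdc R n + 2 ^- n) ->
    (N <= 2 ^ k)%N -> 0 <= t <= 1 ->
  `|(nb_below x t N)%:R - N%:R * t| <= 3 * k.+1%:R.
Proof.
move=> x0 xP N2k t01.
pose s := [seq 2 ^ j | j <- iota 0 k]%N ++ iota 0 k.
have size_s : size s = (k + k)%N by rewrite size_cat size_map size_iota.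
have [|upper lower] := @nb_below_perturb R x (vdc R) (2 ^- k) t s N.
  move=> n nN; rewrite mem_cat negb_or mem_iota /= add0n -leqNgt => /andP[ns kn].
  have /xP : ~~ is_pow2 n.
    apply: contra ns => /eqP n2; apply/mapP; exists (trunc_log 2 n) => //.
    by rewrite mem_iota /= add0n -(ltn_exp2l (m := 2)) // -n2 (leq_trans nN).
  have : 2 ^- n <= 2 ^- k :> R.
    by rewrite lef_pV2 ?posrE ?exprn_gt0 // ler_eXn2l // ltr1n.
  by lra.
have d0 : 0 < 2 ^- k :> R by rewrite invr_gt0 exprn_gt0.
have Nd : N%:R * 2 ^- k <= 1 :> R.
  by rewrite ler_pdivrMr ?exprn_gt0 // mul1r -natrX ler_nat.
have N0 : 0 <= N%:R :> R by [].
move: upper lower; rewrite size_s -!(ler_nat R) !natrD => upper lower.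
rewrite -(natr1 k).
have := @vdc_discrepancy R k N t N2k t01; rewrite !ler_norml -natr1 => dt.
apply/andP; split; last by lra.
have [td|td] := leP (2 ^- k) t.
  have td01 : 0 <= t - 2 ^- k <= 1 by lra.
  have := @vdc_discrepancy R k N (t - 2 ^- k) N2k td01.
  by rewrite !ler_norml -natr1; lra.
have : N%:R * t <= N%:R * 2 ^- k by rewrite ler_wpM2l // ltW.
have : 0 <= (nb_below x t N)%:R :> R by [].
have : 0 <= k%:R :> R by [].
by lra.
Qed.

(** * From logarithmic counting error to low discrepancy *)

(** For N >= 2 and k the least exponent with N <= 2 ^ k, the bound
    2 ^ (k - 1) < N gives (k + 1) * ln 2 <= 3 * ln N. *)
Lemma low_discrepancyP (R : realType) (x : nat -> R) (c : R) :
    0 < c -> (forall n, 0 <= x n < 1) ->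
    (forall k N t, (N <= 2 ^ k)%N -> 0 <= t <= 1 ->
      `|(nb_below x t N)%:R - N%:R * t| <= c * k.+1%:R) ->
  low_discrepancy x.
Proof.
move=> c0 x01 xP; split=> [n|]; first by rewrite in_itv /= x01.
have ln2 : 0 < ln 2 :> R by rewrite ln_gt0 // ltr1n.
apply/eqO_exP; exists (3 * c / ln 2); first by rewrite divr_gt0 ?mulr_gt0.
exists 2%N => // N /= N2.
have N0 : 0 < N%:R :> R by rewrite ltr0n (leq_trans _ N2).
pose E := [set `| #|[pred n : 'I_N | 0 <= x n < t]|%:R / N%:R - t |
      | t in `]0, 1[ ].
have /andP[kN Nk] : (2 ^ (up_log 2 N).-1 < N <= 2 ^ up_log 2 N)%N.
  exact: up_log_bounds.
have k0 : (0 < up_log 2 N)%N by rewrite up_log_gt0; lia.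
set k := up_log 2 N in kN Nk k0.
have E_le e : E e -> e <= (c * k.+1%:R) / N%:R.
  move=> [t /=]; rewrite in_itv /= => /andP[t0 t1] <-.
  have -> : #|[pred n : 'I_N | 0 <= x n < t]| = nb_below x t N.
    rewrite /nb_below -sum1_card -sum1_count.
    rewrite -[X in iota 0 X]subn0 -/(index_iota 0 N).
    by rewrite big_mkord; apply: eq_bigl => i; rewrite inE; have /andP[->] := x01 i.
  rewrite ler_pdivlMr // -[X in _ * X]ger0_norm // -normrM mulrBl divfK ?gt_eqF //.
  by rewrite [t * _]mulrC xP // !ltW.
have E_half : E `| #|[pred n : 'I_N | 0 <= x n < 2^-1]|%:R / N%:R - 2^-1 |.
  by exists (2^-1) => //=; rewrite in_itv /=; lra.
have supE_le : sup E <= (c * k.+1%:R) / N%:R.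
  by apply: ge_sup => //; eexists; exact: E_half.
have supE_ge : 0 <= sup E.
  apply: le_trans (ub_le_sup _ E_half) => //.
  by exists ((c * k.+1%:R) / N%:R).
have lnN : ln 2 <= ln (N%:R : R) by rewrite ler_ln ?posrE // ler_nat.
have lnkN : (k%:R - 1) * ln 2 <= ln (N%:R : R).
  rewrite -[k]prednK // -natr1 addrK mulr_natl -lnXn //.
  by rewrite ler_ln ?posrE ?exprn_gt0 // -natrX ler_nat ltnW.
rewrite /star_discrepancy -/E ger0_norm // ger0_norm; last first.
  by rewrite mulr_ge0 ?invr_ge0 // ?ltW // (lt_le_trans ln2).
apply: le_trans supE_le _; rewrite mulrCA [X in _ <= X]mulrC.
rewrite ler_pM2r ?invr_gt0 // mulrAC ler_pdivlMr //.
rewrite -mulrA [3 * c]mulrC -mulrA ler_pM2l // -natr1.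
by lra.
Qed.

(** * Dense countable sets can be enumerated with low discrepancy *)

Definition dense01 (R : realType) (A : set R) : Prop :=
  forall a b, 0 <= a -> a < b -> b <= 1 -> exists2 z, A z & a <= z < b.

(** A point to be avoided lies outside one of the two halves of [a, b). *)
Lemma dense_avoiding (R : realType) (A : set R) (s : seq R) (a b : R) :
    dense01 A ->
    0 <= a -> a < b -> b <= 1 ->
  exists2 z, A z & (z \notin s) && (a <= z < b).
Proof.
move=> dA; elim: s a b => [|c s IH] a b a0 ab b1.
  by have [z Az zab] := dA a b a0 ab b1; exists z.
have [cm|mc] := ltP c ((a + b) / 2).
  have [||| z Az /andP[zs zab]] := IH ((a + b) / 2) b; try lra.
  exists z => //; rewrite inE negb_or zs /=.
  have -> : z != c by rewrite gt_eqF //; lra.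
  by lra.
have [||| z Az /andP[zs zab]] := IH a ((a + b) / 2); try lra.
exists z => //; rewrite inE negb_or zs /=.
have -> : z != c by rewrite lt_eqF //; lra.
by lra.
Qed.

(** [sparse_bijection], applied to any enumeration of [A], selects points close
    to the van der Corput points at all times but the powers of two. *)
Lemma dense_low_discrepancy (R : realType) (A : set R) :
    countable A -> (forall z, A z -> 0 <= z < 1) ->
    dense01 A ->
  exists x : nat -> R, ordering A x /\ low_discrepancy x.
Proof.
move=> A_countable A01 A_dense.
have A_infinite : infinite_set A.
  move=> /finite_seqP[s As].
  have [|||z Az /andP[/negP zs _]] := @dense_avoiding R A s 0 1 A_dense => //.
  by apply: zs; move: Az; rewrite As.
have /card_set_bijP[e [eA e_inj e_surj]] : ([set: nat] #= A)%card.
  by rewrite card_eq_le; apply/andP; split => //; exact/infiniteP.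
have eAT n : A (e n) by exact: eA.
have e_injT : injective e by move=> m n; apply: e_inj; rewrite inE.
have [i|n s|sigma [sigma_inj sigma_surj sigmaP]] :=
    @sparse_bijection is_pow2 (fun n m => vdc R n <= e m < vdc R n + 2 ^- n).
- exists (2 ^ i)%N; first by rewrite ltnW // ltn_expl.
  by rewrite /is_pow2 trunc_expnK.
- pose b := Num.min (vdc R n + 2 ^- n) 1.
  have vdc01 := vdc_itv R n.
  have d0 : 0 < 2 ^- n :> R by rewrite invr_gt0 exprn_gt0.
  have [|||z Az /andP[zs zb]] :=
      @dense_avoiding R A [seq e m | m <- s] (vdc R n) b A_dense;
    rewrite /b; try lra.
  + by rewrite lt_min; lra.
  + by rewrite ge_min lexx orbT.
  + have [m _ em] := e_surj z Az; exists m.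
      by move: zs; rewrite -em mem_map.
    by rewrite em; move: zb; rewrite lt_min; lra.
exists (e \o sigma); split.
  split=> [n _|m n _ _ /e_injT/sigma_inj //|z /e_surj[m _ <-]]; first exact: eAT.
  by have [n <-] := sigma_surj m; exists n.
apply: (@low_discrepancyP _ _ 3) => // [n|k N t Nk t01]; first exact: A01 _ (eAT _).
by apply: perturbed_vdc_discrepancy => // n; have /andP[] := A01 _ (eAT (sigma n)).
Qed.

(** * The map on the long and on the short intervals

    With L = l + 1 and S = s + 1, the points of [0, 1) are written either
    v + j * beta with j < L and 0 <= v < beta, or
    v + L * beta + j * beta ^ 2 with j < S and 0 <= v < beta ^ 2. *)

Lemma ls_left_long (R : realType) (L : nat) (beta : R) (j : nat) :
  (j <= L)%N -> ls_left L beta j.+1 = j%:R * beta.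
Proof.
rewrite /ls_left; elim: j => [|j IH] jL; first by rewrite big_geq // mul0r.
by rewrite big_nat_recr //= IH ?(ltnW jL) // /ls_length jL -natr1 mulrDl mul1r.
Qed.

Lemma ls_left_short (R : realType) (L : nat) (beta : R) (j : nat) :
  ls_left L beta (L + j).+1 = L%:R * beta + j%:R * beta ^+ 2.
Proof.
elim: j => [|j IH]; first by rewrite addn0 ls_left_long // mul0r addr0.
rewrite addnS /ls_left big_nat_recr //= -/(ls_left L beta (L + j).+1) IH.
by rewrite /ls_length ltnNge leq_addr /= -addrA -natr1 mulrDl mul1r.
Qed.

Lemma le_ls_left (R : realType) (L : nat) (beta : R) (i j : nat) :
  0 <= beta -> (0 < i)%N -> (i <= j)%N -> ls_left L beta i <= ls_left L beta j.
Proof.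
move=> b0 i0 ij; rewrite /ls_left (big_cat_nat (n := i) (p := j)) //= lerDl.
by apply: sumr_ge0 => k _; rewrite /ls_length; case: ifP => _; rewrite ?exprn_ge0.
Qed.

Lemma ls_map_interval (R : realType) (L S : nat) (beta x : R) (i : nat) :
    0 <= beta -> (i < L + S)%N ->
    ls_left L beta i.+1 <= x < ls_left L beta i.+2 ->
  ls_map L S beta x = x + ls_shift L S beta i.+1.
Proof.
move=> b0 iLS /andP[x_ge x_lt]; rewrite /ls_map; congr (x + _).
have left_succ j : (0 < j)%N ->
    ls_left L beta j + ls_length L beta j = ls_left L beta j.+1.
  by move=> j0; rewrite /ls_left big_nat_recr.
rewrite (bigD1_seq i.+1) ?iota_uniq //=; last by rewrite mem_index_iota.
rewrite big1_seq => [|j /andP[ji]].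
  rewrite addr0 indicE mem_set ?mulr1 // /ls_interval /= in_itv /=.
  by rewrite left_succ // x_ge.
rewrite mem_index_iota => /andP[j0 _]; rewrite indicE memNset ?mulr0 //.
rewrite /ls_interval /= in_itv /= left_succ // => /andP[x_ge' x_lt'].
have [ji'|ij|//] := ltngtP j i.+1; last by move/eqP: ji.
  by have := lt_le_trans x_lt' (le_ls_left L b0 (ltn0Sn _) ji'); rewrite ltNge x_ge.
by have := lt_le_trans x_lt (le_ls_left L b0 (ltn0Sn _) ij); rewrite ltNge x_ge'.
Qed.

Lemma ls_map_first (R : realType) (l s : nat) (beta v : R) :
    0 <= v < beta ->
  ls_map l.+1 s.+1 beta v = v + l%:R * beta + beta ^+ 2.
Proof.
move=> v_itv; rewrite (@ls_map_interval _ _ _ _ _ 0) ?addSn //.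
- by rewrite /ls_shift /= -natr1; ring.
- by lra.
- by rewrite !ls_left_long // mul0r mul1r.
Qed.

Lemma ls_map_long (R : realType) (l s : nat) (beta v : R) (j : nat) :
    (j < l)%N -> 0 <= v < beta ->
  ls_map l.+1 s.+1 beta (v + j.+1%:R * beta) = v + j%:R * beta.
Proof.
move=> jl v_itv; rewrite (@ls_map_interval _ _ _ _ _ j.+1); first 1 last.
- by lra.
- by lia.
- by rewrite !ls_left_long; [rewrite -!natr1; lra | lia | lia].
by rewrite /ls_shift ltnS jl -natr1 /=; ring.
Qed.

Lemma ls_map_short (R : realType) (l s : nat) (beta v : R) (j : nat) :
    0 <= beta -> (j < s)%N -> 0 <= v < beta ^+ 2 ->
  ls_map l.+1 s.+1 beta (v + l.+1%:R * beta + j%:R * beta ^+ 2) =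
  v + l.+1%:R * beta + j.+1%:R * beta ^+ 2.
Proof.
move=> b0 js v_itv; rewrite (@ls_map_interval _ _ _ _ _ (l.+1 + j)%N) //;
  first 1 last.
- by lia.
- by rewrite ls_left_short -addnS ls_left_short -!natr1; lra.
have long_lt : (l.+1 + j < l.+1)%N = false by lia.
have short_lt : ((l.+1 + j).+1 < l.+1 + s.+1)%N by lia.
by rewrite /ls_shift /= long_lt short_lt -[j.+1%:R]natr1; ring.
Qed.

Lemma ls_map_last (R : realType) (l s : nat) (beta v : R) :
    0 <= beta -> 0 <= v < beta ^+ 2 ->
  ls_map l.+1 s.+1 beta (v + l.+1%:R * beta + s%:R * beta ^+ 2) =
  v + l%:R * beta.
Proof.
move=> b0 v_itv; rewrite (@ls_map_interval _ _ _ _ _ (l.+1 + s)%N) //;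
  first 1 last.
- by lia.
- by rewrite ls_left_short -addnS ls_left_short -!natr1; lra.
have long_lt : (l.+1 + s < l.+1)%N = false by lia.
have short_lt : ((l.+1 + s).+1 < l.+1 + s.+1)%N = false by lia.
by rewrite /ls_shift /= long_lt short_lt -!natr1; ring.
Qed.

Lemma nat_floor_decomposition (R : realType) (c x : R) (n : nat) :
    0 < c -> 0 <= x < n%:R * c ->
  exists j v, [/\ (j < n)%N, 0 <= v < c & x = v + j%:R * c].
Proof.
move=> c0 /andP[x0 x_lt]; pose j := Num.truncn (x / c).
have /andP[j_le j_gt] : j%:R <= x / c < j.+1%:R.
  by apply: truncn_itv; rewrite divr_ge0 // ltW.
rewrite ler_pdivlMr // in j_le; rewrite ltr_pdivrMr // -natr1 in j_gt.
exists j, (x - j%:R * c); split; [|by lra | by rewrite subrK].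
by rewrite -(ltr_nat R) -(ltr_pM2r c0) (le_lt_trans j_le).
Qed.

Lemma ls_cover (R : realType) (l s : nat) (beta x : R) :
    0 < beta -> l.+1%:R * beta + s.+1%:R * beta ^+ 2 = 1 -> 0 <= x < 1 ->
  (exists j v, [/\ (j < l.+1)%N, 0 <= v < beta & x = v + j%:R * beta]) \/
  (exists j v, [/\ (j < s.+1)%N, 0 <= v < beta ^+ 2
                 & x = v + l.+1%:R * beta + j%:R * beta ^+ 2]).
Proof.
move=> b0 beta_eq x01; have [xl|xs] := ltP x (l.+1%:R * beta).
  by left; apply: nat_floor_decomposition => //; rewrite xl; lra.
right; have [||j [v [js v_itv xE]]] :=
  @nat_floor_decomposition R (beta ^+ 2) (x - l.+1%:R * beta) s.+1.
- by rewrite exprn_gt0.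
- by lra.
by exists j, v; split=> //; lra.
Qed.

Lemma beta_bounds (R : realType) (l s : nat) (beta : R) :
    0 < beta -> l.+1%:R * beta + s.+1%:R * beta ^+ 2 = 1 ->
  0 < beta ^+ 2 < beta.
Proof.
move=> b0; have b2 : 0 < beta ^+ 2 by rewrite exprn_gt0.
rewrite b2 /= -!natr1 => beta_eq.
have : 0 <= l%:R * beta by rewrite mulr_ge0 // ltW.
have : 0 <= s%:R * beta ^+ 2 by rewrite mulr_ge0 // ltW.
by move=> s0 l0; rewrite expr2 -[ltRHS]mulr1 ltr_pM2l //; lra.
Qed.

Lemma long_point_in (R : realType) (l s : nat) (beta v : R) (j : nat) :
    0 < beta -> l.+1%:R * beta + s.+1%:R * beta ^+ 2 = 1 ->
    (j < l.+1)%N -> 0 <= v < beta ->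
  0 <= v + j%:R * beta < 1.
Proof.
move=> b0 beta_eq jl v_itv.
have b2 : 0 < s.+1%:R * beta ^+ 2 by rewrite mulr_gt0 ?exprn_gt0.
have : 0 <= j%:R * beta by rewrite mulr_ge0 // ltW.
have : j.+1%:R * beta <= l.+1%:R * beta by rewrite ler_pM2r // ler_nat.
by rewrite -[j.+1%:R]natr1; lra.
Qed.

Lemma short_point_in (R : realType) (l s : nat) (beta v : R) (j : nat) :
    0 < beta -> l.+1%:R * beta + s.+1%:R * beta ^+ 2 = 1 ->
    (j < s.+1)%N -> 0 <= v < beta ^+ 2 ->
  0 <= v + l.+1%:R * beta + j%:R * beta ^+ 2 < 1.
Proof.
move=> b0 beta_eq js v_itv.
have lb : 0 < l.+1%:R * beta by rewrite mulr_gt0.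
have b2 : 0 < beta ^+ 2 by rewrite exprn_gt0.
have : 0 <= j%:R * beta ^+ 2 by rewrite mulr_ge0 // ltW.
have : j.+1%:R * beta ^+ 2 <= s.+1%:R * beta ^+ 2 by rewrite ler_pM2r // ler_nat.
by rewrite -[j.+1%:R]natr1; lra.
Qed.

Lemma ls_map_itv (R : realType) (l s : nat) (beta x : R) :
    0 < beta -> l.+1%:R * beta + s.+1%:R * beta ^+ 2 = 1 -> 0 <= x < 1 ->
  0 <= ls_map l.+1 s.+1 beta x < 1.
Proof.
move=> b0 beta_eq x01; have b2 := beta_bounds b0 beta_eq.
have := ls_cover b0 beta_eq x01.
case=> [[[|j] [v [jl v_itv ->]]]|[j [v [js v_itv ->]]]].
- rewrite mul0r addr0 ls_map_first // -addrA.
  have : 0 <= l%:R * beta by rewrite mulr_ge0 // ltW.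
  have : 0 <= s%:R * beta ^+ 2 by rewrite mulr_ge0 //; lra.
  by move: beta_eq; rewrite -!natr1; lra.
- by rewrite ls_map_long //; apply: (long_point_in b0 beta_eq) => //; lia.
- have [js'|sj] := ltnP j s.
    by rewrite ls_map_short ?(ltW b0) //; apply: (short_point_in b0 beta_eq).
  have -> : j = s by lia.
  by rewrite ls_map_last ?(ltW b0) //;
      apply: (long_point_in b0 beta_eq) => //; lra.
Qed.

(** The preimages are read off the rearranged order of the intervals
    I_2, ..., I_L, I_{L+S}, I_1, I_{L+1}, ..., I_{L+S-1}: the image of I_1
    straddles I_L and I_{L+1}, covering I_{L+1} and the part of I_L that the
    image of I_{L+S} leaves free. *)
Lemma ls_map_surj (R : realType) (l s : nat) (beta : R) :
    0 < beta -> l.+1%:R * beta + s.+1%:R * beta ^+ 2 = 1 ->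
  set_surj (`[0, 1[ : set R) (`[0, 1[ : set R) (ls_map l.+1 s.+1 beta).
Proof.
move=> b0 beta_eq z /=; rewrite in_itv /= => z01.
have b2 := beta_bounds b0 beta_eq.
suff [x x01 <-] : exists2 x, 0 <= x < 1 & ls_map l.+1 s.+1 beta x = z.
  by exists x => //=; rewrite in_itv.
have := ls_cover b0 beta_eq z01.
case=> [[j [v [jl v_itv ->]]]|[[|j] [v [js v_itv ->]]]].
- have [jl'|lj] := ltnP j l.
    exists (v + j.+1%:R * beta); last exact: ls_map_long.
    exact: (long_point_in b0 beta_eq).
  have -> : j = l by lia.
  have [vb|bv] := ltP v (beta ^+ 2).
    exists (v + l.+1%:R * beta + s%:R * beta ^+ 2).
      by apply: (short_point_in b0 beta_eq) => //; lra.
    by rewrite ls_map_last //; lra.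
  exists (v - beta ^+ 2); last by rewrite ls_map_first; lra.
  have := @long_point_in R l s beta (v - beta ^+ 2) 0 b0 beta_eq isT.
  by rewrite mul0r addr0; apply; lra.
- exists (v + beta - beta ^+ 2).
    have := @long_point_in R l s beta (v + beta - beta ^+ 2) 0 b0 beta_eq isT.
    by rewrite mul0r addr0; apply; lra.
  by rewrite ls_map_first -?natr1; lra.
- exists (v + l.+1%:R * beta + j%:R * beta ^+ 2).
    by apply: (short_point_in b0 beta_eq) => //; lia.
  by rewrite ls_map_short ?(ltW b0).
Qed.

(** * Dense rotations *)

(** Steps of a small positive size d = q * alpha - p, taken from a point not above
    a + k, cannot jump over [a + k, b + k). *)
Lemma rotation_dense (R : realType) (alpha theta a b : R) :
    (forall e : R, 0 < e -> exists q p : nat, 0 < q%:R * alpha - p%:R < e) ->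
    a < b ->
  exists (n : nat) (k : int), a <= theta + n%:R * alpha - k%:~R < b.
Proof.
move=> small ab; have [|q [p]] := small (b - a); first by rewrite subr_gt0.
set d := q%:R * alpha - p%:R => /andP[d0 dab].
pose k : int := Num.ceil (theta - a).
have ak : theta <= a + k%:~R by have := ceil_ge (theta - a); lra.
(* the first step count that reaches past a + k *)
pose m := (Num.truncn ((a + k%:~R - theta) / d)).+1.
have /andP[m_le m_gt] : m.-1%:R <= (a + k%:~R - theta) / d < m%:R.
  by apply: truncn_itv; rewrite divr_ge0 ?(ltW d0) // subr_ge0.
rewrite ler_pdivlMr // in m_le; rewrite ltr_pdivrMr // in m_gt.
exists (m * q)%N, (k + (m * p)%N%:Z).
have -> : theta + (m * q)%:R * alpha - (k + (m * p)%N%:Z)%:~R =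
    theta + m%:R * d - k%:~R.
  by rewrite intrD -pmulrn !natrM /d; ring.
have : m%:R * d = m.-1%:R * d + d by rewrite -[m]prednK // -natr1 mulrDl mul1r.
by lra.
Qed.

(** With mu = S * beta < 1 and mu ^ 2 = S - L * mu, multiplication by mu ^ 2
    preserves the form q * mu - p with natural coefficients; hence the odd
    powers of mu, which are positive and tend to 0, all have it. *)
Lemma beta_small_multiples (R : realType) (l s : nat) (beta e : R) :
    0 < beta -> l.+1%:R * beta + s.+1%:R * beta ^+ 2 = 1 -> (s <= l)%N ->
    0 < e ->
  exists q p : nat, 0 < q%:R * beta - p%:R < e.
Proof.
move=> b0 beta_eq sl e0; pose mu := s.+1%:R * beta.
have mu0 : 0 < mu by rewrite mulr_gt0.
have mu1 : mu < 1.
  have : mu <= l.+1%:R * beta by rewrite ler_pM2r // ler_nat.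
  have : 0 < s.+1%:R * beta ^+ 2 by rewrite mulr_gt0 ?exprn_gt0.
  by lra.
have mu2 : mu ^+ 2 = s.+1%:R - l.+1%:R * mu.
  have sbE : s.+1%:R * beta ^+ 2 = 1 - l.+1%:R * beta by lra.
  have -> : mu ^+ 2 = s.+1%:R * (s.+1%:R * beta ^+ 2) by rewrite /mu; ring.
  by rewrite sbE /mu; ring.
have odd_power n : exists q p : nat, mu ^+ (n.*2.+1) = q%:R * mu - p%:R.
  elim: n => [|n [q [p IH]]]; first by exists 1%N, 0%N; rewrite expr1; ring.
  exists (q * (s.+1 + l.+1 ^ 2) + p * l.+1)%N, (q * l.+1 * s.+1 + p * s.+1)%N.
  have -> : mu ^+ (n.+1.*2.+1) = mu ^+ (n.*2.+1) * mu ^+ 2.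
    by rewrite -exprD; congr (_ ^+ _); lia.
  rewrite IH !natrD !natrM !natrD natrX.
  have -> : (q%:R * mu - p%:R) * mu ^+ 2 =
      q%:R * (mu * mu ^+ 2) - p%:R * mu ^+ 2 by ring.
  have -> : mu * mu ^+ 2 =
      (s.+1%:R + l.+1%:R ^+ 2) * mu - l.+1%:R * s.+1%:R.
    rewrite {1}mu2.
    have -> : mu * (s.+1%:R - l.+1%:R * mu) = s.+1%:R * mu - l.+1%:R * mu ^+ 2.
      by ring.
    by rewrite mu2; ring.
  by rewrite mu2; ring.
have [n mun] : exists n, mu ^+ n < e.
  have /cvgrPdist_lt/(_ e e0)[n _ nP] : (fun n => mu ^+ n) @ \oo --> (0 : R).
    by apply: cvg_expr; rewrite ger0_norm // ltW.
  exists n; have := nP n (leqnn n).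
  by rewrite sub0r normrN ger0_norm // exprn_ge0 // ltW.
have [q [p qpE]] := odd_power n; exists (q * s.+1)%N, p.
have -> : (q * s.+1)%:R * beta - p%:R = mu ^+ (n.*2.+1).
  by rewrite qpE /mu natrM; ring.
rewrite exprn_gt0 // (le_lt_trans _ mun) // ler_wiXn2l ?ltW //.
by rewrite -addnn -addnS leq_addr.
Qed.

(** * Orbits of the map are dense *)

(** The levels above the base point [v] of I_1 that a forward orbit visits on
    its way to [v]: the translates of [v] into the long intervals, and
    into the short ones if [v] is small enough to have such translates. *)
Definition contains_levels (R : realType) (l s : nat) (beta : R) (O : set R)
    (v : R) : Prop :=
  (forall j, (j < l.+1)%N -> O (v + j%:R * beta)) /\
  (v < beta ^+ 2 -> forall j, (j < s.+1)%N ->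
     O (v + l.+1%:R * beta + j%:R * beta ^+ 2)).

(** The image of u in I_1 is v + (L - 1) * beta with v = u + beta ^ 2 when
    v < beta, and otherwise v + L * beta with v = u + beta ^ 2 - beta.  In the
    second case the orbit climbs the short levels over v first; in both it then
    descends the long levels down to v. *)
Lemma first_return (R : realType) (l s : nat) (beta u : R) (O : set R) :
    0 < beta -> l.+1%:R * beta + s.+1%:R * beta ^+ 2 = 1 ->
    (forall z, O z -> O (ls_map l.+1 s.+1 beta z)) ->
    O u -> 0 <= u < beta ->
  exists v, [/\ v = u + beta ^+ 2 \/ v = u + beta ^+ 2 - beta, 0 <= v < beta
    & contains_levels l s beta O v].
Proof.
move=> b0 beta_eq closed Ou u_itv; have b2 := beta_bounds b0 beta_eq.
have descend v : 0 <= v < beta -> O (v + l%:R * beta) ->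
    forall j, (j < l.+1)%N -> O (v + j%:R * beta).
  move=> v_itv top j; rewrite ltnS => /subKn <-.
  elim: (l - j)%N => [|i IH]; first by rewrite subn0.
  have [il|li] := ltnP i l; last by rewrite (_ : l - i.+1 = l - i)%N; [|lia].
  rewrite -(@ls_map_long _ l s); [|lia|exact: v_itv].
  by apply: closed; rewrite -subSn // subSS.
have [ub|bu] := ltP u (beta - beta ^+ 2).
  exists (u + beta ^+ 2); split; [by left | by lra | split; last by lra].
  apply: descend; first by lra.
  by rewrite addrAC -(@ls_map_first _ l s) //; apply: closed.
have v_itv : 0 <= u + beta ^+ 2 - beta < beta ^+ 2 by lra.
have climb j : (j < s.+1)%N ->
    O (u + beta ^+ 2 - beta + l.+1%:R * beta + j%:R * beta ^+ 2).
  elim: j => [_|j IH js].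
    have -> : u + beta ^+ 2 - beta + l.+1%:R * beta + 0 * beta ^+ 2 =
        u + l%:R * beta + beta ^+ 2 by rewrite -natr1; ring.
    by rewrite -(@ls_map_first _ l s) //; apply: closed.
  by rewrite -(@ls_map_short _ l s) ?(ltW b0) //; apply/closed/IH; lia.
exists (u + beta ^+ 2 - beta); split; [by right | by lra |].
split=> [|_]; last exact: climb.
apply: descend; first by lra.
by rewrite -(@ls_map_last _ l s) ?(ltW b0) //; apply/closed/climb.
Qed.

(** The return points to I_1 are dense there, being an orbit of a rotation; a
    subinterval of any I_i is translated down to I_1, hit there by a return
    point, and the hit is translated back by [contains_levels]. *)
Lemma forward_orbit_dense (R : realType) (l s : nat) (beta x0 : R) (O : set R) :
    0 < beta -> l.+1%:R * beta + s.+1%:R * beta ^+ 2 = 1 -> (s <= l)%N ->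
    (forall z, O z -> O (ls_map l.+1 s.+1 beta z)) ->
    O x0 -> 0 <= x0 < beta ->
  dense01 O.
Proof.
move=> b0 beta_eq sl closed Ox0 x0_itv; have b2 := beta_bounds b0 beta_eq.
have returns n : exists v (k : int),
    [/\ v = x0 + n.+1%:R * beta ^+ 2 - k%:~R * beta, 0 <= v < beta
      & contains_levels l s beta O v].
  elim: n => [|n [u [k [uE u_itv [Ou _]]]]].
    have [v [vE v_itv Ov]] := first_return b0 beta_eq closed Ox0 x0_itv.
    by case: vE => vE; exists v; [exists 0|exists 1]; split=> //; rewrite vE; ring.
  have Ou0 : O u by have := Ou 0%N isT; rewrite mul0r addr0.
  have [v [vE v_itv Ov]] := first_return b0 beta_eq closed Ou0 u_itv.
  case: vE => vE; exists v; [exists k|exists (k + 1)]; split=> //;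
    by rewrite vE uE ?intrD -[n.+2%:R]natr1; ring.
have hit c d : 0 <= c -> c < d -> d <= beta -> exists2 v,
    c <= v < d & contains_levels l s beta O v.
  (* in units of beta the return map is the rotation by beta modulo 1 *)
  move=> c0 cd db; have cd' : c / beta < d / beta by rewrite ltr_pM2r ?invr_gt0.
  have [n [k]] := @rotation_dense _ beta (x0 / beta + beta) _ _
    (fun e => beta_small_multiples b0 beta_eq sl) cd'.
  rewrite ler_pdivrMr // ltr_pdivlMr //.
  have -> : (x0 / beta + beta + n%:R * beta - k%:~R) * beta =
      x0 + n.+1%:R * beta ^+ 2 - k%:~R * beta.
    by rewrite -natr1; field; rewrite gt_eqF.
  move=> cwd; have [v [k' [vE v_itv Ov]]] := returns n; exists v => //.
  (* both representatives modulo beta lie in [0, beta) *)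
  suff -> : v = x0 + n.+1%:R * beta ^+ 2 - k%:~R * beta by [].
  rewrite vE; suff -> : k' = k by [].
  have diffE : (k' - k)%:~R * beta =
      x0 + n.+1%:R * beta ^+ 2 - k%:~R * beta - v by rewrite vE intrB; ring.
  have : (-1)%:~R * beta < (k' - k)%:~R * beta < 1%:~R * beta.
    by rewrite diffE mulrN1z mulr1z; lra.
  by rewrite !(ltr_pM2r b0) !ltr_int; clear -k k'; lia.
move=> a b a0 ab b1; have a01 : 0 <= a < 1 by lra.
have [[j [w [jl w_itv aE]]]|[j [w [js w_itv aE]]]] := ls_cover b0 beta_eq a01.
  have [|||v v_itv [Ov _]] := hit w (Num.min (b - j%:R * beta) beta).
  - by lra.
  - by rewrite lt_min; lra.
  - by rewrite ge_min lexx orbT.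
  exists (v + j%:R * beta); first exact: Ov.
  by move: v_itv; rewrite lt_min; lra.
have [|||v v_itv [_ Ov]] :=
    hit w (Num.min (b - l.+1%:R * beta - j%:R * beta ^+ 2) (beta ^+ 2)).
- by lra.
- by rewrite lt_min; lra.
- by rewrite ge_min; apply/orP; right; lra.
exists (v + l.+1%:R * beta + j%:R * beta ^+ 2).
  by apply: Ov => //; move: v_itv; rewrite lt_min; lra.
by move: v_itv; rewrite lt_min; lra.
Qed.

(** The inverse iterates stay in [0, 1) because the map is onto [0, 1), so that
    [pinv] never takes its default value there. *)
Lemma ls_orbit_itv (R : realType) (l s : nat) (beta x0 z : R) :
    0 < beta -> l.+1%:R * beta + s.+1%:R * beta ^+ 2 = 1 -> 0 <= x0 < 1 ->
  ls_orbit l.+1 s.+1 beta x0 z -> 0 <= z < 1.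
Proof.
move=> b0 beta_eq x0_itv [i _ <-]; case: i => n.
  by rewrite /ls_iter; elim: n => //= n IH; apply: ls_map_itv.
rewrite /ls_iter; elim: n.+1 => // {}n IH; rewrite iterS.
have /(_ (pinv (`[0, 1[ : set R) (ls_map l.+1 s.+1 beta)
  (iter n (pinv (`[0, 1[ : set R) (ls_map l.+1 s.+1 beta)) x0))) :=
  surjpinv_image_sub (dflt := fun=> point) (ls_map_surj b0 beta_eq).
by rewrite /= in_itv /=; apply; eexists; last reflexivity; rewrite /= in_itv.
Qed.

Unset Implicit Arguments.

Theorem corollary3p9 (R : realType) (L S : nat) (beta : R) (r q0 : int) (x0 : R)
    (hL : (1 <= L)%N) (hS : (1 <= S)%N)
    (beta_gt0 : 0 < beta)
    (beta_eq : L%:R * beta + S%:R * beta ^+ 2 = 1)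
    (hq0 : ls_interval L beta 1 (fract (- r%:~R * beta - q0%:~R * beta ^+ 2)))
    (hq0S : ~ ls_interval L beta 1
              (fract (- r%:~R * beta - (q0 + 1)%:~R * beta ^+ 2)))
    (hx0 : x0 = fract (- r%:~R * beta - q0%:~R * beta ^+ 2))
    (hLS : (S <= L)%N) :
  exists x : nat -> R, ordering (ls_orbit L S beta x0) x /\ low_discrepancy x.
Proof.
case: L => // l in hL beta_eq hq0 hq0S hLS *.
case: S => // s in hS beta_eq hLS *.
have x0_itv : 0 <= x0 < beta.
  move: hq0; rewrite -hx0 /ls_interval /= in_itv /= (@ls_left_long _ _ _ 0) //.
  by rewrite mul0r add0r /ls_length.
have x0_01 : 0 <= x0 < 1.
  have := @long_point_in R l s beta x0 0 beta_gt0 beta_eq isT x0_itv.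
  by rewrite mul0r addr0.
pose O : set R := range (fun n => iter n (ls_map l.+1 s.+1 beta) x0).
apply: dense_low_discrepancy => [|z|a b a0 ab b1].
- exact: (sub_countable (card_image_le _ _) (countableP _)).
- exact: ls_orbit_itv.
- (* the forward half of the orbit is already dense *)
  have [||z [n _ <-] zab] :=
    @forward_orbit_dense R l s beta x0 O beta_gt0 beta_eq hLS _ _ x0_itv a b a0 ab b1.
  + by move=> z [n _ <-]; exists n.+1.
  + by exists 0%N.
  by exists (iter n (ls_map l.+1 s.+1 beta) x0) => //; exists n%:Z.
Qed.
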